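(* Let $(W,S)$ be a Coxeter system of rank $n$, and let $w\in W$ be represented by an $S$-reduced word $\mathbf{s}=u_1\cdots u_p$. Let $D(\mathbf{s})$ be a deletion set for $\mathbf{s}$, and let $\tilde{\mathbf{s}}$ be the word obtained from $\mathbf{s}$ by omitting the letters $u_i$ with $i\in D(\mathbf{s})$ (so $\omega(\tilde{\mathbf{s}})=1$). Let $m$ be the minimal number of braid-moves occurring in a finite sequence of nil-moves and braid-moves transforming $\tilde{\mathbf{s}}$ into the empty word. Then \[ l_{R_n}(\omega_n(\mathbf{s}))-2m\leq l_R(w). \]
   Context: $(W,S)$ is a Coxeter system, $S=\{s_1,\dots,s_n\}$, $W=\langle S\mid s_i^2=(s_is_j)^{m_{ij}}=1\rangle$ with $m_{ij}\in\{2,3,\dots\}\cup\{\infty\}$. $S^*$ is the free monoid of words over $S$; $\omega:S^*\to W$ is the canonical surjection. $W_n$ denotes the universal Coxeter group on the same generators $S$ (all $m_{ij}=\infty$, i.e. only relations $s_i^2=1$), with canonical surjection $\omega_n:S^*\to W_n$. Reflections are the conjugates of elements of $S$; $R$ (resp. $R_n$) is the set of reflections in $W$ (resp. $W_n$), and $l_R$ (resp. $l_{R_n}$) is the reflection length, the minimal number of reflections whose product is the element. A word is $S$-reduced if no shorter word represents the same element. A deletion set for a word $u_1\cdots u_p$ is a set of indices $\{i_1<\dots<i_q\}\subseteq\{1,\dots,p\}$ of minimal cardinality such that $\omega(u_1\cdots\hat u_{i_1}\cdots\hat u_{i_q}\cdots u_p)=1$ (hats denote omission). A nil-move replaces a consecutive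 subword $ss$ ($s\in S$) by the empty word. For finite $m_{ij}$, let $\mathbf{b}_{ij}$ be the alternating word in $s_i,s_j$ of length $m_{ij}$ starting with $s_i$; a braid-move replaces a consecutive subword $\mathbf{b}_{ij}$ by $\mathbf{b}_{ji}$. *)

(* Defs.v *)
From Stdlib Require Import Relations.Relation_Definitions Relations.Relation_Operators.
From mathcomp Require Import all_boot.
Set Implicit Arguments. Unset Strict Implicit. Unset Printing Implicit Defensive.

Definition word (n : nat) := seq 'I_n.

(* Coxeter matrix: None encodes m_ij = infinity. *)
Definition coxmat (n : nat) := 'I_n -> 'I_n -> option nat.

Definition is_coxeter_matrix n (M : coxmat n) : Prop :=
  (forall i, M i i = Some 1) /\
  (forall i j, M i j = M j i) /\
  (forall i j k, i != j -> M i j = Some k -> 2 <= k).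

Definition univ_coxmat n : coxmat n := fun i j => if i == j then Some 1 else None.

Definition alt n (i j : 'I_n) (k : nat) : word n :=
  mkseq (fun l => if odd l then j else i) k.

(* Defining relators (s_i s_j)^{m_ij} (for m_ij finite); for i = j this is s_i s_i. *)
Definition relator n (M : coxmat n) (r : word n) : Prop :=
  exists i j k, M i j = Some k /\ r = alt i j (2 * k).

Definition rel_step n (M : coxmat n) (u v : word n) : Prop :=
  exists a b r, relator M r /\ u = a ++ r ++ b /\ v = a ++ b.

(* omega(u) = omega(v) in W = <S | s_i^2 = (s_i s_j)^{m_ij} = 1> :
   the congruence on S^* generated by the relators. *)
Definition coxeq n (M : coxmat n) : relation (word n) :=
  clos_refl_sym_trans (word n) (@rel_step n M).

Definition reduced n (M : coxmat n) (s : word n) : Prop :=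
  forall t, coxeq M t s -> size s <= size t.

Definition delete n (s : word n) (D : {set 'I_(size s)}) : word n :=
  mask [seq i \notin D | i <- enum 'I_(size s)] s.
Arguments delete {n} s D.

Definition deletion_set n (M : coxmat n) (s : word n) (D : {set 'I_(size s)}) : Prop :=
  coxeq M (delete s D) [::] /\
  forall D' : {set 'I_(size s)}, coxeq M (delete s D') [::] -> #|D| <= #|D'|.
Arguments deletion_set {n} M s D.

Definition nil_move n (u v : word n) : Prop :=
  exists a b (x : 'I_n), u = a ++ [:: x; x] ++ b /\ v = a ++ b.

Definition braid_move n (M : coxmat n) (u v : word n) : Prop :=
  exists a b (i j : 'I_n) k, i != j /\ M i j = Some k /\
    u = a ++ alt i j k ++ b /\ v = a ++ alt j i k ++ b.

Inductive reduces_with n (M : coxmat n) : word n -> nat -> Prop :=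
  | red_empty : reduces_with M [::] 0
  | red_nil u v k : nil_move u v -> reduces_with M v k -> reduces_with M u k
  | red_braid u v k : braid_move M u v -> reduces_with M v k -> reduces_with M u k.+1.

Definition min_braid_moves n (M : coxmat n) (u : word n) (m : nat) : Prop :=
  reduces_with M u m /\ forall k, reduces_with M u k -> m <= k.

(* omega(s) is a product of k reflections (conjugates omega(v) t omega(v)^{-1}
   of generators t; omega(v)^{-1} = omega(rev v)). *)
Definition refl_prod n (M : coxmat n) (s : word n) (k : nat) : Prop :=
  exists rs : seq (word n * 'I_n), size rs = k /\
    coxeq M s (flatten [seq r.1 ++ r.2 :: rev r.1 | r <- rs]).

Definition refl_length n (M : coxmat n) (s : word n) (l : nat) : Prop :=
  refl_prod M s l /\ forall k, refl_prod M s k -> l <= k.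

(* Main.v *)
(** Deleting the letters of D from s writes omega_n(s) as a product of #|D|
reflections times the value of the remaining word, and in the universal group
a braid move multiplies a word by a conjugate of (s_i s_j)^m_ij, a product of
two reflections; hence l_Rn <= #|D| + 2m.

It remains to see that #|D| <= l_R(w) (Dyer). Say that t is an inversion of g
when l(g t) < l(g); by strong exchange, following an inversion deletes one
letter from any word for g. Dyer's theorem follows once a product of k
reflections is joined to 1 by at most k successive inversions. A path
g r < g > g t with r <> t has a peak at g, which can be replaced by a path
through an element g r p of the same dihedral coset shorter than g: otherwise
every reflection of the dihedral group <r, t> would be an inversion of every
other, and conjugating by simple reflections to shorten one of them leads to a
contradiction. *)
Require Import Defs.
From Stdlib Require Import Relations.Relation_Operators.
From HB Require Import structures.
From mathcomp Require Import all_boot generic_quotient boolp.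

Set Implicit Arguments. Unset Strict Implicit. Unset Printing Implicit Defensive.

(** * Words in involutions and products of reflections *)

Section InvolutionWords.
Variables (n : nat) (G : groupType) (gen : 'I_n -> G).
Hypothesis gen2 : forall i, (gen i * gen i = 1)%g.
Local Open Scope group_scope.

Definition wval (u : word n) : G := \prod_(x <- u) gen x.

Definition reflection (t : G) : Prop := exists v i, t = gen i ^ v.

Inductive refl_product : nat -> G -> Prop :=
| refl_product0 : refl_product 0 1
| refl_productS k g t :
    refl_product k g -> reflection t -> refl_product k.+1 (g * t).

Lemma wval_nil : wval [::] = 1.
Proof. exact: big_nil. Qed.

Lemma wval_cons x u : wval (x :: u) = gen x * wval u.
Proof. exact: big_cons. Qed.

Lemma wval_cat u v : wval (u ++ v) = wval u * wval v.
Proof. exact: big_cat. Qed.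

Lemma wval1 x : wval [:: x] = gen x.
Proof. exact: big_seq1. Qed.

Lemma genV i : (gen i)^-1 = gen i.
Proof. exact: mulg1_eq. Qed.

Lemma wval_rev u : wval (rev u) = (wval u)^-1.
Proof.
elim: u => [|x u IHu]; first by rewrite /= wval_nil invg1.
by rewrite rev_cons -cats1 wval_cat wval1 wval_cons IHu invgM genV.
Qed.

Lemma reflection_gen i : reflection (gen i).
Proof. by exists 1, i; rewrite conjg1. Qed.

Lemma reflectionJ t g : reflection t -> reflection (t ^ g).
Proof. by case=> v [i ->]; exists (v * g), i; rewrite conjgM. Qed.

Lemma reflection2 t : reflection t -> t * t = 1.
Proof. by case=> v [i ->]; rewrite -conjMg gen2 conj1g. Qed.

Lemma reflectionK t g : reflection t -> g * t * t = g.
Proof. by move=> rt; rewrite -mulgA reflection2 ?mulg1. Qed.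

Lemma reflectionV t : reflection t -> t^-1 = t.
Proof. by move/reflection2/mulg1_eq. Qed.

Lemma refl_product1 t : reflection t -> refl_product 1 t.
Proof.
move=> rt; rewrite -[t]mul1g; apply: refl_productS => //.
exact: refl_product0.
Qed.

Lemma refl_productM j k g h :
  refl_product j g -> refl_product k h -> refl_product (j + k) (g * h).
Proof.
move=> Pg; elim=> [|{}k {}h t _ IHh rt]; first by rewrite addn0 mulg1.
by rewrite addnS mulgA; apply: refl_productS.
Qed.

Lemma refl_productJ k g h : refl_product k g -> refl_product k (g ^ h).
Proof.
elim=> [|{}k {}g t _ IHg rt]; first by rewrite conj1g; exact: refl_product0.
by rewrite conjMg; apply: refl_productS => //; apply: reflectionJ.
Qed.

(** * Rotations in the dihedral group of two reflections *)

Section Rotations.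
Variables a b : G.
Hypotheses (ra : reflection a) (rb : reflection b).

(** The cyclic group generated by [a * b], built so that induction runs over integer exponents of
    either sign. *)
Inductive rotation : G -> Prop :=
| rotation1 : rotation 1
| rotationR r : rotation r -> rotation (r * (a * b))
| rotationRV r : rotation r -> rotation (r * (a * b)^-1).

Lemma rotationM r q : rotation r -> rotation q -> rotation (r * q).
Proof.
move=> Rr; elim=> [|{}q _ IHq|{}q _ IHq]; first by rewrite mulg1.
- by rewrite mulgA; apply: rotationR.
- by rewrite mulgA; apply: rotationRV.
Qed.

Lemma rotation_base : rotation (a * b).
Proof. by rewrite -[_ * _]mul1g; apply/rotationR/rotation1. Qed.

Lemma rotation_baseV : rotation (a * b)^-1.
Proof. by rewrite -[_^-1]mul1g; apply/rotationRV/rotation1. Qed.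

Lemma rotationV r : rotation r -> rotation r^-1.
Proof.
elim=> [|{}r _ IHr|{}r _ IHr]; first by rewrite invg1; exact: rotation1.
- by rewrite invgM; apply: rotationM rotation_baseV IHr.
- by rewrite invgM invgK; apply: rotationM rotation_base IHr.
Qed.

Lemma rotation_exp k : rotation ((a * b) ^+ k).
Proof.
elim: k => [|k IHk]; first exact: rotation1.
by rewrite expgSr; apply: rotationR.
Qed.

Lemma rotation_commute r : rotation r -> commute (a * b) r.
Proof.
elim=> [|{}r _ cr|{}r _ cr]; first exact: commute1.
- by apply: commuteM.
- by apply: commuteM => //; apply: commuteV.
Qed.

Lemma rotation_conjl r : rotation r -> a * r * a = r^-1.
Proof.
elim=> [|{}r Rr IHr|{}r Rr IHr]; first by rewrite mulg1 reflection2 ?invg1.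
- rewrite -[in RHS](rotation_commute Rr) [in RHS]invgM -IHr invgM.
  rewrite !reflectionV //.
  by rewrite !mulgA.
- have rc := commuteV (commute_sym (rotation_commute Rr)).
  rewrite [in RHS]rc [in RHS]invgM invgK -IHr invgM !reflectionV // !mulgA.
  by rewrite !reflectionK.
Qed.

Lemma rotation_conjr r : rotation r -> b * r * b = r^-1.
Proof.
move=> Rr; have cr := rotation_commute (rotationV Rr).
have: (a * b)^-1 * (a * r * a) * (a * b) = r^-1.
  by rewrite rotation_conjl // -mulgA -cr mulKg.
by rewrite invgM (reflectionV ra) (reflectionV rb) !mulgA !reflectionK.
Qed.

(** Both claims are proved together: lengthening [r] by [a * b] turns [a * r] into the old [b * r],
    and [b * r] into the old [a * r] conjugated by [a] and then by [b]. Lengthening by the inverse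
    swaps the two roles. *)
Lemma rotation_reflection r :
  rotation r -> reflection (a * r) /\ reflection (b * r).
Proof.
elim=> [|{}r Rr [ar br]|{}r Rr [ar br]]; first by rewrite !mulg1.
- split.
    rewrite !mulgA (rotation_conjl Rr) -(rotation_conjr Rr) -mulgA.
    by rewrite reflection2 // mulg1.
  have := reflectionJ b (reflectionJ a ar).
  by rewrite !conjgE (reflectionV ra) (reflectionV rb) !mulgA reflectionK.
- rewrite invgM !reflectionV //; split.
    have := reflectionJ a (reflectionJ b br).
    by rewrite !conjgE (reflectionV ra) (reflectionV rb) !mulgA reflectionK.
  rewrite !mulgA (rotation_conjr Rr) -(rotation_conjl Rr) -mulgA.
  by rewrite reflection2 // mulg1.
Qed.

Lemma rotation_refl_product r : rotation r -> refl_product 2 r.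
Proof.
move=> Rr; have [ar _] := rotation_reflection Rr.
rewrite -[r]mul1g -(reflection2 ra) -mulgA.
by apply: (refl_productM (refl_product1 ra) (refl_product1 ar)).
Qed.

End Rotations.

(** * Alternating words, letter deletion and braid moves *)

Lemma altS (i j : 'I_n) k : alt i j k.+1 = i :: alt j i k.
Proof.
rewrite /alt /mkseq /= (iotaDl 1 0) -map_comp; congr (_ :: _).
by apply: eq_map => l /=; case: odd.
Qed.

Lemma wval_alt_double i j k : wval (alt i j (2 * k)) = (gen i * gen j) ^+ k.
Proof.
elim: k => [|k IHk]; first exact: wval_nil.
by rewrite mulnS !altS !wval_cons IHk mulgA expgS.
Qed.

Lemma wval_alt_swap i j k :
  wval (alt i j k) * (wval (alt j i k))^-1 = (gen i * gen j) ^+ k.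
Proof.
elim: k i j => [|k IHk] i j; first by rewrite /alt /= wval_nil divg1.
rewrite !altS !wval_cons invgM genV mulgA -(mulgA (gen i)) IHk.
rewrite expgSr !mulgA; congr (_ * _).
elim: k {IHk} => [|k IHk]; first by rewrite mul1g mulg1.
by rewrite !expgS !mulgA -(mulgA (gen i * gen j)) IHk !mulgA.
Qed.

Lemma refl_product_delete v u : subseq v u ->
  exists2 g, refl_product (size u - size v) g & wval u = g * wval v.
Proof.
elim: u v => [|x u IHu] [|y v] /=.
- by exists 1; [exact: refl_product0 | rewrite mul1g].
- by [].
- case/(_ [::] (sub0seq _)): IHu => g; rewrite !subn0 => Pg uE _.
  exists (gen x * g); last by rewrite wval_cons uE mulgA.
  exact: refl_productM (refl_product1 (reflection_gen x)) Pg.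
have [<- vu|_ vu] := eqVneq.
  (* A kept letter is moved past [g] by conjugating [g], which preserves the number of
     reflections. *)
  have [g Pg uE] := IHu _ vu; rewrite subSS; exists (g ^ (gen y)^-1).
    exact: refl_productJ.
  by rewrite !wval_cons uE !mulgA -conjgCV.
have [g Pg uE] := IHu _ vu; exists (gen x * g).
  have -> : (size u).+1 - (size v).+1 = (1 + (size u - (size v).+1))%N.
    by rewrite add1n -subSn //; exact: (size_subseq vu).
  exact: refl_productM (refl_product1 (reflection_gen x)) Pg.
by rewrite wval_cons uE mulgA.
Qed.

(** [G] is unrelated to [M], so moves for [M] can be evaluated in the universal group. There a braid
    move changes the value, but only by a conjugate of a rotation, which costs two reflections. *)
Lemma refl_product_reduces (M : coxmat n) u k :
  reduces_with M u k -> refl_product (2 * k) (wval u).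
Proof.
elim=> [|{}u v {}k [a [b [x [-> ->]]]] _ IH|{}u v {}k].
- by rewrite wval_nil; exact: refl_product0.
- by move: IH; rewrite !wval_cat wval_cons wval1 gen2 mul1g.
case=> a [b [i [j [p [_ [_ [-> ->]]]]]]] _ IH.
have -> : wval (a ++ alt i j p ++ b) =
    ((gen i * gen j) ^+ p) ^ (wval a)^-1 * wval (a ++ alt j i p ++ b).
  by rewrite -wval_alt_swap !wval_cat conjgE invgK !mulgA !mulgVK.
rewrite mulnS; apply: refl_productM IH; apply: refl_productJ.
apply: rotation_refl_product; last first.
- exact: rotation_exp.
- exact: reflection_gen.
- exact: reflection_gen.
Qed.

(** * Inversion parity and strong exchange *)

(** Each letter, conjugated by the value of the suffix after it, is the reflection whose right
    multiplication deletes that letter; the occurrences of [t] among these are counted modulo 2. In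
    a Coxeter group this parity depends only on the value of [u], whereas the count does not. *)
Fixpoint inversion_parity (u : word n) (t : G) : bool :=
  if u is x :: v then (t == gen x ^ wval v) (+) inversion_parity v t else false.

Lemma inversion_parity_cat u v t :
  inversion_parity (u ++ v) t =
  inversion_parity v t (+) inversion_parity u (t ^ (wval v)^-1).
Proof.
elim: u => [|x u IHu] /=; first by rewrite addbF.
rewrite IHu wval_cat conjgM -addbCA; congr (_ (+) (_ (+) _)).
by rewrite -(inj_eq (@conjg_inj _ (wval v)^-1)) conjgK.
Qed.

Lemma strong_exchange u t : inversion_parity u t ->
  exists a x b, u = a ++ x :: b /\ wval u * t = wval (a ++ b).
Proof.
elim: u => [|x u IHu] //=; have [-> _|_] := eqVneq.
  exists [::], x, u; split=> //=.
  by rewrite wval_cons conjgE -!mulgA mulVKg mulgA gen2 mul1g.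
case/IHu=> a [y [b [-> E]]]; exists (x :: a), y, b; split=> //=.
by rewrite !wval_cons -E mulgA.
Qed.

(** * Length and inversions of group elements *)

Section Exchange.
Hypothesis wval_surj : forall g, exists u, wval u = g.
Hypothesis inversion_parity_wval :
  forall u v t, wval u = wval v -> inversion_parity u t = inversion_parity v t.

Lemma length_subproof g : exists k, [exists u : k.-tuple 'I_n, wval u == g].
Proof.
have [u uE] := wval_surj g; exists (size u).
by apply/existsP; exists (in_tuple u); rewrite /= uE.
Qed.

Definition len g := ex_minn (length_subproof g).

Lemma len_min u : len (wval u) <= size u.
Proof.
rewrite /len; case: ex_minnP => k _; apply.
by apply/existsP; exists (in_tuple u).
Qed.

Lemma len_word g : exists2 u, wval u = g & size u = len g.
Proof.
rewrite /len; case: ex_minnP => k /existsP [u /eqP uE] _.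
by exists u; rewrite ?size_tuple.
Qed.

Definition inv g t := len (g * t) < len g.

Lemma len_exchange u t : inversion_parity u t -> len (wval u) = size u ->
  inv (wval u) t.
Proof.
move=> /strong_exchange [a [x [b [-> E]]]] lu; rewrite /inv E lu.
by apply: leq_ltn_trans (len_min _) _; rewrite !size_cat /= addnS.
Qed.

(** Represent [t] by a palindrome [rev w ++ i :: w]. As [t] fixes [s], the two outer halves
    contribute as they do in [rev w ++ w], a word for 1, hence cancel; only the middle letter is
    left, and it reads [t]. *)
Lemma inversion_parity_commute s t :
  reflection s -> reflection t -> commute t s ->
  forall u, wval u = t -> inversion_parity u s = (t == s).
Proof.
move=> rs [v [i ->]] cts u uE; have [w wE] := wval_surj v.
rewrite (@inversion_parity_wval u (rev w ++ i :: w)); last first.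
  by rewrite uE wval_cat wval_cons wval_rev wE conjgE.
rewrite inversion_parity_cat /=.
have := @inversion_parity_wval (rev w ++ w) [::] s.
rewrite wval_cat wval_rev mulVg wval_nil inversion_parity_cat /= => /(_ erefl).
have -> : s ^ (wval (i :: w))^-1 = s ^ (wval w)^-1.
  have si : s ^ (gen i ^ v) = s by rewrite conjgE -cts mulKg.
  rewrite -[in LHS]si -conjgM wval_cons wE; congr (_ ^ _).
  by rewrite conjgE invgM genV !mulgA mulgK -mulgA gen2 mulg1.
rewrite wE [s == _]eq_sym; case: (inversion_parity w s);
  by case: (inversion_parity _ _); case: eqP.
Qed.

Lemma inversion_parityE u t :
  reflection t -> inversion_parity u t = inv (wval u) t.
Proof.
move=> rt; have [v vE lv] := len_word (wval u).
rewrite (inversion_parity_wval t (esym vE)) -vE.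
have [vt|vt] := boolP (inversion_parity v t).
  by apply/esym/len_exchange; rewrite // vE.
(* If the parity at [t] is even for the element, it is odd after multiplication by [t], because [t]
   contributes itself once. The product is then shortened by [t], so the original element is the
   shorter one. *)
apply/esym/negbTE; rewrite -leqNgt.
have [q qE lq] := len_word (wval v * t).
have [r rE] := wval_surj t.
have: inversion_parity q t.
  rewrite (@inversion_parity_wval _ (v ++ r)) ?wval_cat ?rE ?qE //.
  rewrite inversion_parity_cat rE.
  have -> : t ^ t^-1 = t by rewrite conjgE invgK mulgV mulg1.
  rewrite (negbTE vt) addbF (inversion_parity_commute rt rt _ rE) ?eqxx //.
move=> /len_exchange; rewrite qE lq => /(_ erefl).
by rewrite /inv -mulgA reflection2 // mulg1 => /ltnW.
Qed.

(** The concatenation rule for parities becomes a cocycle identity on group elements. *)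
Lemma invM g h t :
  reflection t -> inv (g * h) t = inv h t (+) inv g (t ^ h^-1).
Proof.
move=> rt; have [u <-] := wval_surj g; have [v <-] := wval_surj h.
rewrite -wval_cat -!inversion_parityE ?inversion_parity_cat //.
exact: reflectionJ.
Qed.

Lemma inv_gen x t : reflection t -> inv (gen x) t = (t == gen x).
Proof.
by move=> rt; rewrite -wval1 -inversion_parityE //= wval_nil conjg1 addbF wval1.
Qed.

Lemma inv_commute s t :
  reflection s -> reflection t -> commute t s -> inv t s = (t == s).
Proof.
move=> rs rt cts; have [u uE] := wval_surj t.
by rewrite -(inversion_parity_commute rs rt cts uE) inversion_parityE // uE.
Qed.

Lemma inv_self t : reflection t -> inv t t.
Proof. by move=> rt; rewrite inv_commute ?eqxx. Qed.

Lemma inv1 t : inv 1 t = false.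
Proof.
apply/negbTE; rewrite -leqNgt; apply: leq_trans (leq0n _).
by rewrite -wval_nil; apply: len_min.
Qed.

Lemma lenV g : len g^-1 = len g.
Proof.
suff le h : len h^-1 <= len h by apply/eqP; rewrite eqn_leq le -{1}[g]invgK le.
by have [u <- <-] := len_word h; rewrite -wval_rev -(size_rev u) len_min.
Qed.

(** * Simple descents and the lowering of peaks *)

Lemma inv_gen_ex g : 0 < len g -> exists x, inv g (gen x).
Proof.
have [u <- lu] := len_word g; rewrite -lu.
case/lastP: u lu => // u x lu _; exists x; rewrite /inv -lu.
rewrite -cats1 wval_cat wval1 -mulgA gen2 mulg1 size_cat addn1 ltnS.
exact: len_min.
Qed.

(** Multiplying by the simple reflection on the left does not lengthen [a]. It then still is a
    descent on the right unless it commutes with [a], and a reflection has no commuting inversion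
    but itself. *)
Lemma len_conj_gen a x :
  reflection a -> inv a (gen x) -> a <> gen x -> len (a ^ gen x) < len a.
Proof.
move=> ra ax neq; have rx := reflection_gen x.
apply: (@leq_trans (len (gen x * a))); last first.
  by rewrite -lenV invgM genV (reflectionV ra) ltnW.
have : inv (gen x * a) (gen x); last by rewrite /inv conjgE genV mulgA.
rewrite invM // ax inv_gen; last exact: reflectionJ.
apply/negP => /eqP xa; apply/neq/eqP; rewrite -inv_commute //.
by rewrite /commute -{2}xa conjgE invgK !mulgA mulgVK.
Qed.

(* Conjugating T by a simple reflection s outside T that is a descent of some
   member preserves mutual inversion and shortens that member; when s is in T
   itself, s has no inversion but s. *)
Lemma mutual_inversions_eq (T : G -> Prop) a b :
  (forall r, T r -> reflection r) ->
  (forall r t, T r -> T t -> T (t ^ r)) ->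
  (forall r t, T r -> T t -> inv r t) ->
  T a -> T b -> a = b.
Proof.
have [k] := ubnP (len a); elim: k => // k IHk in T a b *.
rewrite ltnS => la Tr TJ Ti Ta Tb.
have [|x ax] := @inv_gen_ex a; first exact: leq_ltn_trans (Ti a a Ta Ta).
set s := gen x in ax; have rs : reflection s by exact: reflection_gen.
have Vs : s^-1 = s by exact: reflectionV.
have [Ts|nTs] := pselect (T s).
  have eqs t : T t -> t = s.
    by move=> Tt; apply/eqP; rewrite -inv_gen ?Ti //; exact: Tr.
  by rewrite (eqs a Ta) (eqs b Tb).
have sJK t : (t ^ s) ^ s = t by rewrite -conjgM gen2 conjg1.
apply: (@conjg_inj _ s); apply: (IHk (fun t => T (t ^ s))); rewrite ?sJK //.
- apply: leq_trans la; apply: len_conj_gen => //; first exact: Tr.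
  by move=> eas; rewrite eas in Ta.
- by move=> r /Tr; rewrite -{2}(sJK r); apply: reflectionJ.
- by move=> r t Tr' Tt; rewrite conjJg; apply: TJ.
move=> r' t'; rewrite -{2}(sJK r') -{2}(sJK t').
move: (r' ^ s) (t' ^ s) => r t {r' t'} Tr' Tt.
(* The cocycle identity along [s], [r], [s] leaves [inv r t] and two tests for equality with [s];
   success of either test would put [s] into [T]. *)
rewrite [r ^ s]conjgE Vs invM ?inv_gen; try by do ?apply: reflectionJ; apply: Tr.
rewrite invM; last by apply/reflectionJ/Tr.
rewrite conjgK inv_gen; last by apply/reflectionJ/Tr.
have /negbTE-> : t ^ s != s.
  apply/eqP => e; apply: nTs; suff <- : t = s by [].
  by apply: (@conjg_inj _ s); rewrite e conjgE mulKg.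
rewrite Ti //.
have /negbTE-> // : (t ^ s) ^ (r * s)^-1 != s.
apply/eqP => e; apply: nTs.
have tE : t = s ^ r.
  by apply: (@conjg_inj _ s); rewrite -conjgM; apply: canRL (conjgKV _) e.
suff -> : s = t ^ r by apply: TJ.
by rewrite tE -conjgM (reflection2 (Tr _ Tr')) conjg1.
Qed.

Lemma peak_lowering x a b :
  reflection a -> reflection b -> a <> b -> inv x a -> inv x b ->
  exists r t, [/\ reflection r, reflection t, a * r = b * t
               & len (x * a * r) < len x].
Proof.
move=> ra rb neq xa xb; apply: contrapT => nex.
(* Without a lower path [x] is minimal in its coset of rotations: a shorter [x * r] would be reached
   from [x * a] by [a * r] and from [x * b] by [b * r]. *)
have le r : rotation a b r -> len x <= len (x * r).
  move=> Rr; rewrite leqNgt; apply/negP => lt; apply: nex.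
  have [ar br] := rotation_reflection ra rb Rr.
  exists (a * r), (b * r); split=> //; first by rewrite !mulgA !reflection2.
  by rewrite mulgA -(mulgA x) reflection2 ?mulg1.
(* [T] is the set of reflections [a * r] with [r] a rotation. *)
pose T t := rotation a b (a * t).
have refT t : T t -> reflection t.
  by case/(rotation_reflection ra rb); rewrite mulgA reflection2 ?mul1g.
have TJ r t : rotation a b r -> T t -> T (t ^ r).
  move=> Rr Tt; rewrite /T; have -> : a * t ^ r = r * (a * t) * r.
    by rewrite conjgE -(rotation_conjl ra rb Rr) !mulgA reflection2 // mul1g.
  by apply: rotationM => //; apply: rotationM.
have xaT t : T t -> inv (x * a) t = false.
  move=> Tt; apply/negbTE; rewrite -leqNgt -mulgA.
  exact: leq_trans (ltnW xa) (le _ Tt).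
have xbT t : T t -> inv (x * b) t = false.
  move=> Tt; apply/negbTE; rewrite -leqNgt -mulgA.
  apply: leq_trans (ltnW xb) (le _ _).
  have -> : b * t = (a * b)^-1 * (a * t).
    by rewrite invgM !mulgA (reflectionV ra) (reflectionV rb) reflectionK.
  exact: rotationM (rotation_baseV _ _) Tt.
(* Neither [x * a] nor [x * b] has an inversion in [T], and they differ by [a * b]; by the cocycle
   identity [a * b] has none either, and then no rotation has. *)
have cT t : T t -> inv (a * b) t = false.
  move=> Tt; have := xbT t Tt.
  have -> : x * b = x * a * (a * b) by rewrite !mulgA reflectionK.
  rewrite invM; last exact: refT.
  by rewrite xaT ?addbF //; apply/TJ/Tt/rotation_baseV.
have cVT t : T t -> inv (a * b)^-1 t = false.
  move=> Tt; have := inv1 t; rewrite -(mulgV (a * b)) invM; last exact: refT.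
  by rewrite cT ?addbF //; rewrite invgK; apply/TJ/Tt/rotation_base.
have rotT r t : rotation a b r -> T t -> inv r t = false.
  move=> Rr; elim: Rr t => [|{}r _ IHr|{}r _ IHr] t Tt; first exact: inv1.
  - rewrite invM ?cT ?IHr //; last exact: refT.
    by apply/TJ/Tt/rotation_baseV.
  - rewrite invM ?cVT ?IHr //; last exact: refT.
    by rewrite invgK; apply/TJ/Tt/rotation_base.
have reflT r t : rotation a b r -> T t -> inv (a * r) t = inv a (t ^ r^-1).
  by move=> Rr Tt; rewrite invM ?(rotT _ _ Rr Tt) //; apply: refT.
(* With [t = a * r], the reflection [a * r^-1] is an inversion of itself; stripping the rotation by
   [reflT] conjugates it by [r] into [t]. *)
have aT t : T t -> inv a t.
  move=> Tt; set r := a * t; have Rr : rotation a b r by [].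
  have rV := rotationV Rr.
  have tE : t = a * r by rewrite mulgA reflection2 ?mul1g.
  clearbody r.
  have TE : T (a * r^-1) by rewrite /T mulgA reflection2 ?mul1g.
  have [arV _] := rotation_reflection ra rb rV.
  have := inv_self arV; rewrite reflT // invgK conjgE !mulgA mulgVK.
  suff -> : t = r^-1 * a by [].
  rewrite tE -{1}[r]invgK -(rotation_conjl ra rb rV) !mulgA.
  by rewrite reflection2 ?mul1g.
apply/neq/(mutual_inversions_eq refT) => //.
- move=> r t Tr Tt.
  have -> : t ^ r = (t ^ a) ^ (a * r).
    by rewrite -conjgM mulgA reflection2 ?mul1g.
  apply: TJ => //; rewrite /T conjgE (reflectionV ra) !mulgA.
  rewrite reflection2 // mul1g.
  have -> : t * a = (a * t)^-1.
    by rewrite invgM (reflectionV ra) (reflectionV (refT _ Tt)).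
  exact: rotationV.
- move=> r t Tr Tt.
  have -> : r = a * (a * r) by rewrite mulgA reflection2 ?mul1g.
  by rewrite reflT //; apply/aT/TJ/Tt/rotationV.
- by rewrite /T reflection2 //; apply: rotation1.
- exact: rotation_base.
Qed.

(** * Descending chains and Dyer's theorem *)

Inductive descending_chain : nat -> G -> Prop :=
| descending_chain0 : descending_chain 0 1
| descending_chainS k g t : reflection t -> inv g t ->
    descending_chain k (g * t) -> descending_chain k.+1 g.

Lemma descending_chainM k g t : reflection t -> descending_chain k g ->
  exists2 j, j <= k.+1 & descending_chain j (g * t).
Proof.
have [m] := ubnP (len g); elim: m => // m IHm in k g t *.
rewrite ltnS => lg rt Cg.
(* If [t] does not shorten [g], it shortens [g * t], and the step from [g * t] to [g] is put before
   the chain. *)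
have [gt|gt] := boolP (inv g t); last first.
  exists k.+1 => //; apply: (descending_chainS rt); last first.
    by rewrite -mulgA reflection2 ?mulg1.
  by rewrite invM // inv_self //= reflectionV // conjgE mulKg gt.
case: Cg gt lg => [|{}k {}g r rr gr Cgr] gt lg; first by rewrite inv1 in gt.
have [<-|/eqP neq] := eqVneq r t; first by exists k; rewrite // ltnW.
(* Now [g * t = g * r * p * q]. Both [g * r] and [g * r * p] are shorter than [g], so induction
   applies twice; the two possible extra steps are offset in part by dropping the step from [g] to
   [g * r]. *)
have [p [q [rp rq pq lt]]] := peak_lowering rr rt neq gr gt.
have [j jk Cj] := IHm _ _ _ (leq_trans gr lg) rp Cgr.
have [i ij Ci] := IHm _ _ _ (leq_trans lt lg) rq Cj.
exists i; first exact: leq_trans ij _.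
suff -> : g * t = g * r * p * q by [].
by rewrite -(mulgA g) pq !mulgA -(mulgA _ q) reflection2 ?mulg1.
Qed.

Lemma refl_product_descending k g : refl_product k g ->
  exists2 j, j <= k & descending_chain j g.
Proof.
elim=> [|{}k {}g t _ [j jk Cj] rt].
  by exists 0 => //; exact: descending_chain0.
have [i ij Ci] := descending_chainM rt Cj; exists i => //.
exact: leq_trans ij _.
Qed.

(** Strong exchange holds for arbitrary words, so it applies again to the word left after each
    deletion. *)
Lemma descending_chain_delete k u : descending_chain k (wval u) ->
  exists v, [/\ subseq v u, size u <= size v + k & wval v = 1].
Proof.
move eg: (wval u) => g Cg; elim: Cg u eg => [|{}k {}g t rt gt _ IH] u uE.
  by exists u; rewrite addn0.
move: gt; rewrite -uE -inversion_parityE //.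
case/strong_exchange=> a [x [b [ue E]]].
have [|v [vab sz v1]] := IH (a ++ b); first by rewrite -uE.
exists v; split=> //.
  apply: subseq_trans vab _; rewrite ue; apply: cat_subseq => //.
  exact: subseq_cons.
by move: sz; rewrite ue !size_cat /= !addnS ltnS.
Qed.

Lemma dyer_deletion k u : refl_product k (wval u) ->
  exists v, [/\ subseq v u, size u <= size v + k & wval v = 1].
Proof.
case/refl_product_descending => j jk /descending_chain_delete[v [vu sz v1]].
by exists v; split=> //; apply: leq_trans sz _; rewrite leq_add2l.
Qed.

End Exchange.
End InvolutionWords.

(** * The group of a Coxeter matrix *)

Section CoxeterGroup.
Variables (n : nat) (M : coxmat n).
Hypothesis M1 : forall i, M i i = Some 1.

Lemma coxeq_catl a u v : coxeq M u v -> coxeq M (a ++ u) (a ++ v).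
Proof.
elim=> [x y [c [d [r [Mr [-> ->]]]]]|x|x y _ IH|x y z _ IHx _ IHy].
- by apply: rst_step; exists (a ++ c), d, r; rewrite -!catA.
- exact: rst_refl.
- exact: rst_sym.
- exact: rst_trans IHx IHy.
Qed.

Lemma coxeq_catr a u v : coxeq M u v -> coxeq M (u ++ a) (v ++ a).
Proof.
elim=> [x y [c [d [r [Mr [-> ->]]]]]|x|x y _ IH|x y z _ IHx _ IHy].
- by apply: rst_step; exists c, (d ++ a), r; rewrite -!catA.
- exact: rst_refl.
- exact: rst_sym.
- exact: rst_trans IHx IHy.
Qed.

Lemma coxeq_cat u u' v v' :
  coxeq M u u' -> coxeq M v v' -> coxeq M (u ++ v) (u' ++ v').
Proof.
by move=> uu vv; apply: rst_trans (coxeq_catr _ uu) (coxeq_catl _ vv).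
Qed.

Lemma coxeq_rev_cat u : coxeq M (rev u ++ u) [::].
Proof.
elim: u => [|x u IHu]; first exact: rst_refl.
apply: rst_trans IHu; rewrite rev_cons cat_rcons.
apply: rst_step; exists (rev u), u, [:: x; x]; split=> //.
by exists x, x, 1; split; first exact: M1.
Qed.

(** The quotient construction takes a boolean relation, obtained here classically. *)
Definition coxeqb (u v : word n) : bool := `[< coxeq M u v >].

Lemma coxeqb_equiv : equiv_class_of coxeqb.
Proof.
split=> [u|u v|v u w].
- by apply/asboolP; apply: rst_refl.
- by apply/asboolP/asboolP; apply: rst_sym.
- by move=> /asboolP uv /asboolP vw; apply/asboolP; apply: rst_trans uv vw.
Qed.

Canonical coxeq_equiv := EquivRelPack coxeqb_equiv.

(** * The quotient group and its generators *)

Local Open Scope quotient_scope.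

(* Words are invertible only under M1, hence its presence in the carrier. *)
Definition coxgroup of (forall i, M i i = Some 1) := {eq_quot coxeq_equiv}.
Local Notation W := (coxgroup M1).
HB.instance Definition _ := Choice.on W.
HB.instance Definition _ := EqQuotient.on W.

Lemma coxeqP u v : reflect (coxeq M u v) (\pi_W u == \pi_W v).
Proof. by rewrite eqmodE; apply: asboolP. Qed.

Definition cox_mul (g h : W) : W := \pi_W (repr g ++ repr h).
Definition cox_inv (g : W) : W := \pi_W (rev (repr g)).

Lemma coxeq_repr u : coxeq M (repr (\pi_W u)) u.
Proof. by apply/coxeqP; rewrite reprK. Qed.

Lemma pi_cat u v : \pi_W (u ++ v) = cox_mul (\pi_W u) (\pi_W v).
Proof. by apply/esym/eqP/coxeqP/coxeq_cat; apply: coxeq_repr. Qed.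

Lemma cox_mulA : associative cox_mul.
Proof.
elim/quotW=> u; elim/quotW=> v; elim/quotW=> w.
by rewrite -(pi_cat v w) -(pi_cat u v) -(pi_cat u) -(pi_cat _ w) catA.
Qed.

Lemma cox_mul1 : left_id (\pi_W [::]) cox_mul.
Proof. by elim/quotW=> u; rewrite -pi_cat. Qed.

Lemma cox_mulr1 : right_id (\pi_W [::]) cox_mul.
Proof. by elim/quotW=> u; rewrite -pi_cat cats0. Qed.

Lemma cox_mulV : left_inverse (\pi_W [::]) cox_inv cox_mul.
Proof.
move=> g; rewrite -{2}[g]reprK /cox_inv -pi_cat.
exact/eqP/coxeqP/coxeq_rev_cat.
Qed.

Lemma cox_mulVr : right_inverse (\pi_W [::]) cox_inv cox_mul.
Proof.
move=> g; rewrite -{1}[g]reprK /cox_inv -pi_cat -{1}[repr g]revK.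
exact/eqP/coxeqP/coxeq_rev_cat.
Qed.

HB.instance Definition _ :=
  isGroup.Build W cox_mulA cox_mul1 cox_mulr1 cox_mulV cox_mulVr.

Definition cox_gen (i : 'I_n) : W := \pi_W [:: i].

Lemma wval_pi u : wval cox_gen u = \pi_W u.
Proof.
elim: u => [|x u IHu]; first exact: wval_nil.
rewrite wval_cons IHu; exact: (esym (pi_cat [:: x] u)).
Qed.

Lemma wvalP u v : wval cox_gen u = wval cox_gen v <-> coxeq M u v.
Proof. by rewrite !wval_pi; split=> [/eqP/coxeqP|/coxeqP/eqP]. Qed.

Lemma cox_gen2 i : (cox_gen i * cox_gen i = 1)%g.
Proof.
transitivity (\pi_W [:: i; i]); first exact: (esym (pi_cat [:: i] [:: i])).
exact/eqP/coxeqP/(coxeq_rev_cat [:: i]). Qed.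

Lemma cox_surj g : exists u, wval cox_gen u = g.
Proof. by exists (repr g); rewrite wval_pi reprK. Qed.

(** * Invariance of inversion parity under the Coxeter relations *)

Lemma wval_alt_relator i j k : M i j = Some k ->
  ((cox_gen i * cox_gen j) ^+ k = 1)%g.
Proof.
move=> Mij; rewrite -wval_alt_double -(wval_nil cox_gen).
apply/wvalP/rst_step; exists [::], [::], (alt i j (2 * k)).
by rewrite cats0; split=> //; exists i, j, k.
Qed.

(* The reflections read off (s_i s_j)^k are the b c^l with l < 2k, where b = s_j
   and c = s_i s_j; when c^k = 1 each of them occurs twice. *)
Lemma inversion_parity_alt i j k t :
  inversion_parity cox_gen (alt i j (2 * k)) t =
  \big[addb/false]_(0 <= l < k + k)
    (t == cox_gen j * (cox_gen i * cox_gen j) ^+ l)%g.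
Proof.
elim: k => [|k IHk]; first by rewrite big_nil.
rewrite mulnS !altS [LHS]/= IHk addnS addSn !big_nat_recr //=.
rewrite wval_cons wval_alt_double; set a := cox_gen i; set b := cox_gen j.
have cb : ((a * b) ^- k * b = b * (a * b) ^+ k)%g.
  have ra : reflection cox_gen a by apply: reflection_gen.
  have rb : reflection cox_gen b by apply: reflection_gen.
  rewrite -(rotation_conjr cox_gen2 ra rb); last exact: rotation_exp.
  by rewrite (reflectionK cox_gen2).
have -> : (b ^ ((a * b) ^+ k) = b * (a * b) ^+ (k + k))%g.
  by rewrite conjgE mulgA cb expgnDr !mulgA.
have -> : (a ^ (b * (a * b) ^+ k) = b * (a * b) ^+ (k + k).+1)%g.
  rewrite conjgE invgM (genV cox_gen2) -/b cb -addnS expgnDr expgS.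
  by rewrite !mulgA.
by rewrite addbA addbC addbA [RHS]addbAC.
Qed.

Lemma inversion_parity_relator r t :
  relator M r -> inversion_parity cox_gen r t = false.
Proof.
case=> i [j [k [Mij ->]]]; rewrite inversion_parity_alt.
rewrite (@big_cat_nat _ _ _ k) ?leq_addr //= -{2}[k]add0n big_addn addnK.
under [X in _ (+) X]eq_bigr => l _ do
  rewrite expgnDr (wval_alt_relator Mij) mulg1.
by rewrite addbb.
Qed.

(** A relator inside a word has even parity at every element, and its value 1 leaves the conjugate
    of [t] seen by the letters to its left unchanged. *)
Lemma inversion_parity_coxeq u v t : wval cox_gen u = wval cox_gen v ->
  inversion_parity cox_gen u t = inversion_parity cox_gen v t.
Proof.
move/wvalP; elim=> [x y [a [b [r [Mr [-> ->]]]]]|//|x y _ ->//|x y z _ -> _ ->//].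
rewrite !inversion_parity_cat (inversion_parity_relator _ Mr) addbF.
congr (_ (+) _).
have [i [j [k [Mij ->]]]] := Mr.
by rewrite wval_cat wval_alt_double wval_alt_relator ?mul1g.
Qed.

Lemma refl_prodP s k :
  refl_prod M s k <-> refl_product cox_gen k (wval cox_gen s).
Proof.
have wflat rs : wval cox_gen (flatten [seq r.1 ++ r.2 :: rev r.1 | r <- rs]) =
    (\prod_(r <- rs) cox_gen r.2 ^ (wval cox_gen r.1)^-1)%g.
  elim: rs => [|r rs IH]; first by rewrite big_nil wval_nil.
  rewrite /= wval_cat IH big_cons wval_cat wval_cons (wval_rev cox_gen2).
  by rewrite conjgE invgK.
split.
  case=> rs [<- /wvalP ->]; rewrite wflat.
  elim/last_ind: rs => [|rs r IH].
    by rewrite big_nil; apply: refl_product0.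
  rewrite size_rcons -cats1 big_cat big_seq1; apply: refl_productS => //.
  exact/reflectionJ/reflection_gen.
move eg: (wval _ s) => g Pg; elim: Pg s eg => [|{}k {}g t _ IH [v [i ->]]] s sE.
  by exists [::]; split=> //; apply/wvalP; rewrite wval_nil.
have [u uE] := cox_surj g; have [rs [<- /wvalP rsE]] := IH u uE.
(* [gen i ^ v] has [v^-1] on the left, whereas [refl_prod] puts the conjugating word itself
   there. *)
have [w wE] := cox_surj v^-1.
exists (rcons rs (w, i)); rewrite size_rcons; split=> //; apply/wvalP.
by rewrite wflat -cats1 big_cat big_seq1 -wflat -rsE uE wE invgK sE.
Qed.

End CoxeterGroup.

(** * Deletion sets and the inequality *)

Lemma size_delete n (s : word n) (D : {set 'I_(size s)}) :
  size (delete s D) + #|D| = size s.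
Proof.
rewrite /delete size_mask; last by rewrite size_map size_enum_ord.
rewrite count_map.
rewrite -[RHS](card_ord (size s)) -(cardC (mem D)) addnC; congr (_ + _).
rewrite cardE enumT size_filter; apply: eq_count => i; by rewrite !inE.
Qed.

Lemma subseq_delete n (v s : word n) : subseq v s ->
  exists D : {set 'I_(size s)}, delete s D = v.
Proof.
(* The mask is as long as [s], so the default of [nth] is never reached. *)
case/subseqP=> m sm ->; exists [set i : 'I_(size s) | ~~ nth false m i].
rewrite /delete; congr mask; rewrite -[RHS](mkseq_nth false) /mkseq sm.
rewrite -val_enum_ord -map_comp; apply: eq_map => i /=.
by rewrite inE negbK.
Qed.

Theorem theorem2 (n : nat) (M : coxmat n) (HM : is_coxeter_matrix M)
  (s : word n) (Hs : reduced M s)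
  (D : {set 'I_(size s)}) (HD : deletion_set M s D)
  (m : nat) (Hm : min_braid_moves M (delete s D) m)
  (lR lRn : nat) (HlR : refl_length M s lR)
  (HlRn : refl_length (@univ_coxmat n) s lRn) :
  lRn - 2 * m <= lR.
Proof.
have [[M1 _] [_ Dmin]] := (HM, HD).
have U1 (i : 'I_n) : univ_coxmat i i = Some 1 by rewrite /univ_coxmat eqxx.
(* In the group of [M], [lR] reflections give a deletion of at most [lR] letters, and [D] is
   minimal. *)
have DlR : #|D| <= lR.
  have /(refl_prodP M1) := HlR.1.
  case/(dyer_deletion (cox_gen2 M1) (@cox_surj _ _ M1) (@inversion_parity_coxeq _ _ M1)).
  move=> v [/subseq_delete[D' <-] sz v1].
  apply: leq_trans (Dmin D' _) _; first by apply/(wvalP M1); rewrite wval_nil.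
  by rewrite -(size_delete D') leq_add2l in sz.
have gen2 := cox_gen2 U1.
(* In the universal group the deleted letters cost one reflection each, and the remaining word costs
   [2 * m]. *)
have [g Pg sE] : exists2 g, refl_product (cox_gen U1) #|D| g
    & wval (cox_gen U1) s = (g * wval (cox_gen U1) (delete s D))%g.
  rewrite -(addKn (size (delete s D)) #|D|) size_delete.
  exact/refl_product_delete/mask_subseq.
have Pd := refl_product_reduces gen2 Hm.1.
rewrite leq_subLR addnC; apply: leq_trans (HlRn.2 (#|D| + 2 * m) _) _.
  by apply/(refl_prodP U1); rewrite sE; apply: refl_productM.
by rewrite leq_add2r.
Qed.
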